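(* Let $G$ be a pure $\kappa$-sparse gapset with genus $g$. Then $\kappa \leq g$.
   Context: $\mathbb{N}$ denotes the positive integers. A gapset is a finite set $G \subset \mathbb{N}$ such that whenever $z \in G$ and $z = x+y$ with $x,y \in \mathbb{N}$, then $x \in G$ or $y \in G$. The genus of $G$ is its cardinality $g$; we write $G = \{\ell_1 < \ell_2 < \cdots < \ell_g\}$. For $g \geq 2$, $G$ is pure $\kappa$-sparse if $\ell_{i+1}-\ell_i \leq \kappa$ for all $i \in \{1,\dots,g-1\}$ and $\ell_{i+1}-\ell_i = \kappa$ for some $i$. By convention, $\emptyset$ is pure $0$-sparse and $\{1\}$ is pure $1$-sparse (and for no other value of the parameter). *)

(* Defs.v *)
From mathcomp Require Import all_boot finmap.

Set Implicit Arguments.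
Unset Strict Implicit.
Unset Printing Implicit Defensive.

Local Open Scope fset_scope.
Local Open Scope nat_scope.

(* [nat] contains 0, whereas gapsets consist of positive integers. *)
Definition gapset (G : {fset nat}) : Prop :=
  (forall z : nat, z \in G -> 0 < z) /\
  (forall x y z : nat, 0 < x -> 0 < y -> z \in G -> z = x + y ->
     x \in G \/ y \in G).

Definition genus (G : {fset nat}) : nat := #|` G|.

(* [gap G i] is l_i in the increasing enumeration l_1 < ... < l_g of G: the
   index starts at 1, and the value is junk outside 1 <= i <= genus G. *)
Definition gap (G : {fset nat}) (i : nat) : nat :=
  nth 0 (sort leq G) i.-1.

(* Truncated subtraction is harmless, since gap G i < gap G i.+1 whenever
   1 <= i <= genus G - 1. The first two disjuncts are the conventions for the
   gapsets of genus 0 and 1. *)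
Definition pure_sparse (k : nat) (G : {fset nat}) : Prop :=
  [\/ G = fset0 /\ k = 0,
      G = [fset 1] /\ k = 1
    | [/\ 2 <= genus G,
          forall i, 1 <= i <= genus G - 1 -> gap G i.+1 - gap G i <= k
        & exists2 i, 1 <= i <= genus G - 1 & gap G i.+1 - gap G i = k]].

(* Main.v *)
Require Import Defs.
From mathcomp Require Import all_boot finmap zify.

(* If [t = l_(i+1)] and [t - l_i = kappa], then for [0 < y < kappa] the number
   [t - y] lies strictly between two consecutive gaps, so it is not a gap; as
   [t = (t - y) + y] is one, [y] must be a gap. Hence [1, ..., kappa - 1] and
   [t >= kappa] are [kappa] distinct gaps. *)

Local Open Scope nat_scope.

Lemma gap_mem (G : {fset nat}) (i : nat) : 0 < i <= genus G -> gap G i \in G.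
Proof.
case: i => // i /andP[_ lt_ig].
by rewrite -(mem_sort leq) mem_nth // size_sort.
Qed.

(** A member of [G] has an index in the sorted list; by monotonicity it is at most the lower end or
    at least the upper end. *)
Lemma notin_between_gaps (G : {fset nat}) (i x : nat) :
  0 < i -> gap G i < x < gap G i.+1 -> x \notin G.
Proof.
case: i => // i _; rewrite /gap /= => /andP[lt_ix lt_xi].
have sG : sorted leq (sort leq G) := sort_sorted leq_total G.
apply/negP; rewrite -(mem_sort leq) => /(nthP 0)[j lt_j def_x].
have le_nth k l : l < size (sort leq G) -> k <= l ->
    nth 0 (sort leq G) k <= nth 0 (sort leq G) l.
  move=> lt_l le_kl; apply: (sorted_leq_nth leq_trans leqnn) => //.
  exact: leq_ltn_trans le_kl lt_l.
have [le_ji | lt_ij] := leqP j i.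
  (* Otherwise the upper end is the default value 0, which cannot exceed [x]. *)
  have lt_i : i < size (sort leq G).
    by rewrite ltnNge; apply/negP => /leqW/(nth_default 0) eq0; rewrite eq0 in lt_xi.
  by have := le_nth _ _ lt_i le_ji; rewrite def_x leqNgt lt_ix.
by have := le_nth _ _ lt_j lt_ij; rewrite def_x leqNgt lt_xi.
Qed.

Lemma gap_diff_leq_genus (G : {fset nat}) (i : nat) :
  gapset G -> 0 < i < genus G -> gap G i.+1 - gap G i <= genus G.
Proof.
move=> [_ splitG] /andP[i_gt0 lt_ig].
set t := gap G i.+1; set k := t - gap G i.
have tG : t \in G by apply: gap_mem.
(* The list [t :: iota 1 k.-1] has size [k] only for positive [k]. *)
have [-> // | k_gt0] := posnP k.
(* [t] is not repeated, since [k <= t]. *)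
have uniq_s : uniq (t :: iota 1 k.-1).
  by rewrite /= iota_uniq andbT mem_iota; lia.
have -> : k = size (t :: iota 1 k.-1) by rewrite /= size_iota prednK.
apply: uniq_leq_size => // y; rewrite inE => /orP[/eqP-> // |].
rewrite mem_iota => hy.
have /negP tyG : t - y \notin G by apply: (@notin_between_gaps _ i) => //; lia.
by case: (splitG (t - y) y t) => //; lia.
Qed.

Theorem proposition3p3 (G : {fset nat}) (kappa g : nat)
  (hG : gapset G) (hkappa : pure_sparse kappa G) (hg : genus G = g) :
  kappa <= g.
Proof.
rewrite -{}hg; case: hkappa => [[_ ->] // | [-> ->] | [g_ge2 _ [i hi <-]]].
  by rewrite /genus cardfs1.
by apply: gap_diff_leq_genus => //; lia.
Qed.
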